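(* There exists a family of $2$-degenerate graphs $G$ with $\operatorname{mad}(G)<4$ and arbitrarily large maximum degree such that $\chi(G^2)\geqslant \frac{5\Delta(G)}{2}$. That is, for every integer $N$ there is a finite $2$-degenerate graph $G$ with $\operatorname{mad}(G)<4$, $\Delta(G)\geqslant N$, and $\chi(G^2)\geqslant \frac{5\Delta(G)}{2}$.
   Context: $\Delta(G)$ is the maximum degree of $G$. A graph is $2$-degenerate if every nonempty subgraph has a vertex of degree at most $2$. The maximum average degree is $\operatorname{mad}(G)=\max\{2|E(H)|/|V(H)| : H \subseteq G\}$ over (nonempty) subgraphs $H$ of $G$. The square $G^2$ is the graph on $V(G)$ in which two distinct vertices are adjacent if and only if their distance in $G$ is at most $2$; $\chi(G^2)$ is its chromatic number. *)

(* Defs.v *)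
From mathcomp Require Import all_boot all_order all_algebra.

Set Implicit Arguments.
Unset Strict Implicit.
Unset Printing Implicit Defensive.

Import Order.TTheory GRing.Theory Num.Theory.

Record sgraph := SGraph {
  vertex :> finType;
  adj : rel vertex;
  adj_sym : symmetric adj;
  adj_irr : irreflexive adj }.

Section Invariants.
Variable G : sgraph.
Implicit Types (x y : G) (k : nat) (W : {set G}) (F : {set {set G}}).

Definition degree x : nat := #|[set y | adj x y]|.

Definition max_degree : nat := \max_(x : G) degree x.

Definition edges : {set {set G}} :=
  [set [set p.1; p.2] | p : G * G & adj p.1 p.2].

(* (W, F) is a subgraph, not necessarily induced, with vertex set W and edge
   set F. *)
Definition subgraph W F : bool :=
  (F \subset edges) && [forall A in F, A \subset W].

Definition sub_degree F x : nat := #|[set A in F | x \in A]|.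

Definition degenerate k : Prop :=
  forall W F, subgraph W F -> W != set0 ->
    exists2 x, x \in W & (sub_degree F x <= k)%N.

(* All the ratios are nonnegative, so the default value 0 of the maximum only
   matters for the graph without vertices. *)
Definition mad : rat :=
  (\big[Num.max/0]_(H : {set G} * {set {set G}} |
       subgraph H.1 H.2 && (H.1 != set0))
     (2 * #|H.2|%:R / #|H.1|%:R))%R.

Definition has_walk x y k : bool :=
  [exists p : k.-tuple G, path (@adj G) x p && (last x p == y)].

(* The length of a shortest walk, None standing for infinity; in a connected
   component that length is less than the number of vertices. *)
Definition dist x y : option nat :=
  if connect (@adj G) x y then Some (find (has_walk x y) (iota 0 #|G|))
  else None.

Definition dist_le x y k : bool :=
  if dist x y is Some d then (d <= k)%N else false.

Definition colorable k : bool :=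
  [exists f : {ffun G -> 'I_k}, forall x, forall y, adj x y ==> (f x != f y)].

Lemma colorable_ex : exists k, colorable k.
Proof.
exists #|G|; apply/existsP; exists [ffun x => enum_rank x].
apply/forallP => x; apply/forallP => y; apply/implyP => xy.
rewrite !ffunE (inj_eq enum_rank_inj).
by apply: contraTneq xy => ->; rewrite adj_irr.
Qed.

Definition chromatic : nat := ex_minn colorable_ex.

Lemma has_walk_sym k : symmetric (fun x y => has_walk x y k).
Proof.
suff sub x y : has_walk x y k -> has_walk y x k.
  by move=> x y; apply/idP/idP; apply: sub.
case/existsP => p /andP[xp /eqP <-].
have sz : size (rev (belast x p)) == k by rewrite size_rev size_belast size_tuple.
apply/existsP; exists (Tuple sz) => /=; rewrite rev_path.
rewrite (eq_path (e' := @adj G)) ?xp => [|u v]; last by rewrite adj_sym.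
by case: {xp sz p} (tval p) => //= a s; rewrite rev_cons last_rcons.
Qed.

Lemma distC x y : dist x y = dist y x.
Proof.
rewrite /dist (sym_connect_sym (@adj_sym G)); case: connect => //.
by congr Some; apply: eq_find => k; apply: has_walk_sym.
Qed.

Definition square_adj x y : bool := (x != y) && dist_le x y 2.

Lemma square_adj_sym : symmetric square_adj.
Proof. by move=> x y; rewrite /square_adj /dist_le eq_sym distC. Qed.

Lemma square_adj_irr : irreflexive square_adj.
Proof. by move=> x; rewrite /square_adj eqxx. Qed.

Definition square : sgraph := SGraph square_adj_sym square_adj_irr.

End Invariants.

(* Main.v *)
(** Start from a multigraph and view its edges as vertices ("objects") joined to
    their two end points, the hubs; then give every pair of objects with no
    common hub a private common neighbour of degree 2.  In the square the
    objects become a clique.  Orienting every adjacency towards the hubs, each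
    vertex has out-degree at most 2 and hubs have out-degree 0, which yields
    2-degeneracy and mad < 4.  For K_5 with every edge repeated m >= 2 times, a
    hub has degree 4m, an object has degree 2 + 3m <= 4m since it is disjoint
    from 3m others, and the clique has 10m = (5/2)(4m) elements. *)
Require Import Defs.
From mathcomp Require Import all_boot all_order all_algebra.
From mathcomp Require Import zify.

Set Implicit Arguments.
Unset Strict Implicit.
Unset Printing Implicit Defensive.

Import Order.TTheory GRing.Theory Num.Theory.

(** * Degeneracy and [mad] from a height function *)

Section Layered.
Variables (G : sgraph) (h : G -> nat) (k : nat).
Hypothesis adj_height : forall x y : G, adj x y -> h x != h y.

Definition lower (x : G) : {set G} := [set y | adj x y & h y < h x].

Hypothesis card_lower : forall x, #|lower x| <= k.

Lemma subgraph_edgeP (W : {set G}) F A : subgraph W F -> A \in F ->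
  exists x y, [/\ A = [set x; y], adj x y, x \in W & y \in W].
Proof.
case/andP => /subsetP FE /forallP FW AF.
have /imsetP[[x y]] := FE _ AF; rewrite inE /= => xy defA; exists x, y.
have /subsetP AW := implyP (FW A) AF.
by split=> //; apply: AW; rewrite defA !inE eqxx ?orbT.
Qed.

(** At a vertex of maximal height in [W], every edge of the subgraph goes down, so the edge is
    determined by its other end, an element of [lower x]. *)
Lemma layered_degenerate : degenerate G k.
Proof.
move=> W F sub /set0Pn[x0 Wx0].
case: (arg_maxnP h Wx0) => x Wx maxx; exists x => //.
apply: leq_trans (card_lower x); rewrite /sub_degree.
apply: leq_trans (leq_imset_card (fun y => [set x; y]) (lower x)).
apply/subset_leq_card/subsetP => A; rewrite inE => /andP[AF xA].
have [a [b [defA ab Wa Wb]]] := subgraph_edgeP sub AF.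
move: xA; rewrite defA !inE => /orP[]/eqP xE.
  apply/imsetP; exists b; last by rewrite xE.
  by rewrite inE xE ab ltn_neqAle eq_sym adj_height //= -xE; apply: maxx.
apply/imsetP; exists a; last by rewrite xE setUC.
by rewrite inE xE adj_sym ab ltn_neqAle adj_height //= -xE; apply: maxx.
Qed.

(** Charge each edge to its higher end. Each vertex pays for at most [k] edges, and a vertex [x0] of
    minimal height in [W] pays for none; this makes the bound strict. *)
Lemma layered_card_edges (W : {set G}) F : 0 < k -> subgraph W F -> W != set0 ->
  #|F| < k * #|W|.
Proof.
move=> k_gt0 sub /set0Pn[x1 Wx1].
case: (arg_minnP h Wx1) => x0 Wx0 minx0.
pose D := [set p : G * G | (p.1 \in W :\ x0) && (p.2 \in lower p.1)].
have FD : #|F| <= #|D|.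
  apply: leq_trans (leq_imset_card (fun p : G * G => [set p.1; p.2]) D).
  have inD a b : adj a b -> a \in W -> b \in W -> h b < h a -> (a, b) \in D.
    move=> ab Wa Wb lt_ba; rewrite !inE /= Wa ab lt_ba !andbT.
    by apply: contraTneq lt_ba => ->; rewrite -leqNgt; apply: minx0.
  apply/subset_leq_card/subsetP => A AF.
  have [a [b [-> ab Wa Wb]]] := subgraph_edgeP sub AF.
  have := adj_height ab; rewrite neq_ltn => /orP[lt|lt]; apply/imsetP.
    by exists (b, a); rewrite ?inD // 1?adj_sym //= setUC.
  by exists (a, b); rewrite ?inD.
apply: leq_ltn_trans FD _.
have -> : #|D| = \sum_(x in W :\ x0) #|lower x|.
  under eq_bigr do rewrite -sum1_card.
  by rewrite pair_big_dep /= -sum1dep_card.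
apply: (@leq_ltn_trans (\sum_(x in W :\ x0) k)); first exact: leq_sum.
by rewrite sum_nat_const (cardsD1 x0 W) (Wx0 : x0 \in W) mulnC ltn_pmul2l.
Qed.

Lemma layered_mad : 0 < k -> (mad G < 2 * k%:R)%R.
Proof.
(* The default value 0 of the maximum must lie below the bound too. *)
move=> k_gt0; apply: bigmax_lt; first by rewrite mulr_gt0 ?ltr0n.
move=> [W F] /= /andP[sub W0].
have W_gt0 : 0 < #|W| by rewrite card_gt0.
rewrite ltr_pdivrMr ?ltr0n // -mulrA ltr_pM2l ?ltr0n // -natrM ltr_nat.
exact: layered_card_edges.
Qed.

End Layered.

(** * Distance two and cliques *)

Lemma dist_le2 (G : sgraph) (x w y : G) :
  adj x w -> adj w y -> dist_le x y 2.
Proof.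
move=> xw wy; rewrite /dist_le /dist.
rewrite (connect_trans (connect1 xw) (connect1 wy)).
have walk2 : has_walk x y 2.
  by apply/existsP; exists [tuple w; y]; rewrite /= xw wy eqxx.
(* As [find] is at most [#|G|], a value above 2 would put the length 2 inside the searched range,
   where [walk2] stops the search. *)
rewrite leqNgt; apply/negP => lt2; have := before_find 0 lt2.
rewrite nth_iota ?walk2 //.
by apply: leq_trans lt2 _; rewrite -[leqRHS](size_iota 0) find_size.
Qed.

Lemma clique_chromatic (G : sgraph) (T : finType) (g : T -> G) :
  (forall s t, s != t -> adj (g s) (g t)) -> #|T| <= chromatic G.
Proof.
move=> clique; rewrite /chromatic; case: ex_minnP => k /existsP[f /forallP fP] _.
rewrite -[k]card_ord; apply: (@leq_card _ _ (f \o g)) => s t /= fst.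
apply/eqP/contraT => /clique st.
by have /forallP/(_ (g t)) := fP (g s); rewrite st fst eqxx.
Qed.

(** * Linking objects by private common neighbours *)

Section Linking.
Variables (J S : finType) (inc : S -> J -> bool).

Definition unlinked s t := ~~ [exists j, inc s j && inc t j].

Lemma unlinkedC s t : unlinked s t = unlinked t s.
Proof. by congr (~~ _); apply: eq_existsb => j; rewrite andbC. Qed.

Local Notation vtx := (J + S + {set S})%type.

(* The private neighbour of an unlinked pair {s, t} is the set {s, t} itself;
   all other sets are isolated vertices. *)
Definition link_down (u v : vtx) : bool :=
  match u, v with
  | inl (inr s), inl (inl j) => inc s j
  | inr z, inl (inr s) => [exists t, unlinked s t && (z == [set s; t])]
  | _, _ => false
  end.

Definition link_adj u v := link_down u v || link_down v u.

Lemma link_adj_sym : symmetric link_adj.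
Proof. by move=> u v; rewrite /link_adj orbC. Qed.

Lemma link_adj_irr : irreflexive link_adj.
Proof. by case=> [[]|]. Qed.

Definition link_graph := SGraph link_adj_sym link_adj_irr.

Definition link_height (u : link_graph) : nat :=
  match u : vtx with inl (inl _) => 0 | inl (inr _) => 1 | inr _ => 2 end.

Definition object (s : S) : link_graph := inl (inr s).
Definition hub (j : J) : link_graph := inl (inl j).

Lemma link_adj_height (u v : link_graph) :
  adj u v -> link_height u != link_height v.
Proof. by case: u v => [[?|?]|?] [[?|?]|?]. Qed.

(** One down-neighbour already forces [z] to be a pair [[set s; t]], and all down-neighbours are
    elements of [z]. *)
Lemma card_set_down (z : {set S}) : #|[set v | link_down (inr z) v]| <= 2.
Proof.
have [->|[v0]] := set_0Vmem [set v | link_down (inr z) v]; first by rewrite cards0.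
rewrite inE; case: v0 => [[//|s0]|//] /= /existsP[t0 /andP[_ /eqP defz]].
have z2 : #|z| <= 2 by rewrite defz cards2; case: (_ != _).
apply: leq_trans z2; apply: leq_trans (leq_imset_card object z).
apply/subset_leq_card/subsetP => -[[j|s]|w]; rewrite inE //=.
by case/existsP=> t /andP[_ /eqP ->]; rewrite imset_f // !inE eqxx.
Qed.

Lemma card_hub_nbrs j : degree (hub j) = #|[set s | inc s j]|.
Proof.
rewrite -(card_imset _ (f := object)); last by move=> s t [].
apply: eq_card => u; rewrite inE; apply/idP/imsetP => [|[s]].
  by case: u => [[i|s]|z] //= uj; exists s; rewrite ?inE.
by rewrite inE => sj ->.
Qed.

Lemma card_object_down s :
  #|[set v | link_down (object s) v]| = #|[set j | inc s j]|.
Proof.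
rewrite -(card_imset _ (f := hub)); last by move=> i j [].
apply: eq_card => u; rewrite inE; apply/idP/imsetP => [|[j]].
  by case: u => [[j|t]|z] //= sj; exists j; rewrite ?inE.
by rewrite inE => sj ->.
Qed.

(** Besides its hubs, [s] sees only the sets [[set s; t]] with [t] unlinked from [s]. *)
Lemma card_object_nbrs s :
  degree (object s) <= #|[set j | inc s j]| + #|[set t | unlinked s t]|.
Proof.
rewrite -card_object_down.
apply: leq_trans (leq_add (leqnn _)
  (leq_imset_card (fun t => inr [set s; t] : link_graph) _)).
apply: leq_trans (leq_card_setU _ _).1.
apply/subset_leq_card/subsetP => -[[j|t]|z]; rewrite !inE //= => sv.
  by rewrite /adj /= /link_adj /= orbF in sv; rewrite sv.
case/existsP: sv => t /andP[st /eqP ->].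
by apply: imset_f; rewrite inE.
Qed.

Lemma card_set_nbrs z : degree (inr z : link_graph) <= 2.
Proof.
apply: leq_trans (card_set_down z).
apply/subset_leq_card/subsetP => -[[j|t]|w]; rewrite !inE //=.
by rewrite /adj /= /link_adj /= orbF.
Qed.

Lemma object_clique s t : s != t ->
  @adj (square link_graph) (object s) (object t).
Proof.
move=> st; apply/andP; split; first by apply: contra_neq st => -[].
have [/existsP[j /andP[sj tj]]|unl] := boolP [exists j, inc s j && inc t j].
  by apply: (@dist_le2 link_graph _ (hub j)); rewrite /adj /= /link_adj /= ?sj ?tj.
apply: (@dist_le2 link_graph _ (inr [set s; t])); rewrite /adj /= /link_adj /=.
  by apply/existsP; exists t; rewrite eqxx andbT.
by rewrite orbF; apply/existsP; exists s; rewrite unlinkedC setUC eqxx andbT.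
Qed.

Lemma link_chromatic : #|S| <= chromatic (square link_graph).
Proof. exact: (clique_chromatic object_clique). Qed.

Hypothesis card_inc : forall s, #|[set j | inc s j]| <= 2.

Lemma link_card_lower (u : link_graph) : #|lower link_height u| <= 2.
Proof.
have sub : lower link_height u \subset [set v | link_down u v].
  apply/subsetP => v; rewrite !inE => /andP[/orP[//|]].
  by case: u v => [[?|?]|?] [[?|?]|?].
apply: leq_trans (subset_leq_card sub) _.
case: u {sub} => [[j|s]|z]; last exact: card_set_down.
  by rewrite eq_card0 // => -[[?|?]|?]; rewrite inE.
by rewrite card_object_down.
Qed.

Lemma link_degenerate : degenerate link_graph 2.
Proof. exact: (layered_degenerate link_adj_height link_card_lower). Qed.

Lemma link_mad : (mad link_graph < 4)%R.
Proof.
have := layered_mad link_adj_height link_card_lower isT.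
by rewrite -natrM.
Qed.

End Linking.

(** * The multigraph: K_5 with repeated edges *)

(* The edge of K_5 coded by (i, b) joins i to i + 1 + b modulo 5. *)
Definition k5_inc (e : 'I_5 * bool) (j : 'I_5) : bool :=
  (j == e.1 :> nat) || (j == (e.1 + 1 + e.2) %% 5 :> nat).

Lemma k5_card_ends e : #|[set j | k5_inc e j]| = 2.
Proof.
rewrite -sum1dep_card big_mkcond /= !big_ord_recl big_ord0.
by case: e => -[[|[|[|[|[|//]]]]] ?] [].
Qed.

Lemma k5_card_star j : #|[set e | k5_inc e j]| = 4.
Proof.
rewrite -sum1dep_card big_mkcond /=.
rewrite -(pair_bigA _ (fun i b => if k5_inc (i, b) j then 1 else 0)) /=.
rewrite !big_ord_recl big_ord0 !big_bool.
by case: j => [[|[|[|[|[|//]]]]] ?].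
Qed.

(** The edges disjoint from [e] form the triangle on the three vertices that [e] misses. *)
Lemma k5_card_unlinked e : #|[set e' | unlinked k5_inc e e']| = 3.
Proof.
rewrite -sum1dep_card big_mkcond /=.
rewrite -(pair_bigA _ (fun i b => if unlinked k5_inc e (i, b) then 1 else 0)) /=.
(* As a big disjunction over ['I_5], the existential can be expanded term by term, and the ten cases
   for [e] then hold by computation. *)
have unlinkedE s t :
    unlinked k5_inc s t = ~~ \big[orb/false]_j (k5_inc s j && k5_inc t j).
  by rewrite big_orE.
rewrite !big_ord_recl big_ord0 !big_bool !unlinkedE !big_ord_recl !big_ord0.
by case: e => -[[|[|[|[|[|//]]]]] ?] [].
Qed.

Lemma card_fst (A B : finType) (P : pred A) :
  #|[set p : A * B | P p.1]| = #|[set a | P a]| * #|B|.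
Proof.
by rewrite -cardsT -cardsX; apply: eq_card => p; rewrite !inE andbT.
Qed.

(** The ['I_m] component numbers the parallel copies of an edge. Incidence ignores it, so the counts
    of edges in K_5 get multiplied by [m], and copies of one edge are linked. *)
Definition fat_k5_inc m (s : 'I_5 * bool * 'I_m) := k5_inc s.1.

Lemma fat_k5_max_degree m : 1 < m ->
  max_degree (link_graph (@fat_k5_inc m)) = 4 * m.
Proof.
move=> m_gt1.
have hubE j : degree (hub (@fat_k5_inc m) j) = 4 * m.
  by rewrite card_hub_nbrs (card_fst _ (k5_inc^~ j)) k5_card_star card_ord.
apply/eqP; rewrite eqn_leq; apply/andP; split; last first.
  by rewrite -(hubE ord0); apply: leq_bigmax.
apply/bigmax_leqP => -[[j|s]|z] _; first by rewrite hubE.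
  apply: leq_trans (card_object_nbrs _ _) _.
  rewrite k5_card_ends (card_fst _ (unlinked k5_inc s.1)) k5_card_unlinked card_ord.
  lia.
by apply: leq_trans (card_set_nbrs _ _) _; lia.
Qed.

Theorem theorem5 :
  forall N : int, exists G : sgraph,
    [/\ degenerate G 2,
        (mad G < 4)%R,
        (N <= (max_degree G)%:Z)%R
      & (5 * (max_degree G)%:R / 2 <= (chromatic (square G))%:R :> rat)%R].
Proof.
(* Adding 2 secures [1 < m], needed for the maximum degree to be [4 * m]; the absolute value covers
   negative [N]. *)
move=> N; pose m := (`|N|%N).+2.
have ends2 s : #|[set j | @fat_k5_inc m s j]| <= 2 by rewrite k5_card_ends.
exists (link_graph (@fat_k5_inc m)); split.
- exact: link_degenerate.
- exact: link_mad.
- by rewrite fat_k5_max_degree // /m; lia.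
rewrite fat_k5_max_degree // ler_pdivrMr ?ltr0n // -!natrM ler_nat.
(* With the denominator cleared, both sides are [20 * m]: 5 times the degree [4 * m], and twice the
   [10 * m] objects. *)
apply: leq_trans (leq_mul (link_chromatic (@fat_k5_inc m)) (leqnn 2)).
by rewrite !card_prod !card_ord card_bool; lia.
Qed.
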